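(* Let $A$ be a regular system of divisors, $n\in\mathbb N$, and let $\chi$ be a Dirichlet character modulo $n$ with conductor $d$ (so $d\mid n$). Then for every real $x>1$, \[ \prod_{j=1}^n\left(x^{(j-1,n)_A}-1\right)^{\mathrm{Re}(\chi(j))}=\prod_{\substack{\delta\in\mathbb N\\ d\delta\in A(n)}}\Phi_{A,d\delta}(x)^{\varphi(n)/\varphi(d\delta)}, \] where $\varphi$ is Euler's function. In particular, if $\chi$ is a primitive character modulo $n$, then \[ \Phi_{A,n}(x)=\prod_{j=1}^n\left(x^{(j-1,n)_A}-1\right)^{\mathrm{Re}(\chi(j))}. \]
   Context: A regular system of divisors is a family $A=(A(n))_{n\in\mathbb N}$, where each $A(n)$ is a set of positive divisors of $n$, such that: (i) $A(1)=\{1\}$ and $A(mn)=\{de: d\in A(m), e\in A(n)\}$ whenever $\gcd(m,n)=1$; (ii) for every prime power $p^a$ ($a\ge1$) there is a divisor $t=t_A(p^a)$ of $a$ such that $A(p^{it})=\{1,p^t,\dots,p^{it}\}$ for every $0\le i\le a/t$. For $j\in\mathbb Z$ (including $j=0$), $(j,n)_A=\max\{d\in\mathbb N: d\mid j,\ d\in A(n)\}$; $\zeta_n=e^{2\pi i/n}$; $\Phi_{A,n}(x)=\prod_{1\le j\le n,\ (j,n)_A=1}(x-\zeta_n^j)$. *)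

(* Defs.v *)
From HB Require Import structures.
From mathcomp Require Import all_boot all_order all_algebra.
From mathcomp Require Import complex.
From mathcomp Require Import all_classical all_reals all_analysis.

Set Implicit Arguments.
Unset Strict Implicit.
Unset Printing Implicit Defensive.

Import Order.TTheory GRing.Theory Num.Theory.

Local Open Scope classical_set_scope.
Local Open Scope ring_scope.
Local Open Scope complex_scope.

(* Only the values A n with n > 0 matter; A 0 is unconstrained. *)
Record regular_system (A : nat -> set nat) : Prop := RegularSystem {
  regular_dvd : forall n d : nat, (0 < n)%N -> A n d -> (d %| n)%N;
  regular_one : A 1%N = [set 1%N];
  regular_mul : forall m n : nat, (0 < m)%N -> (0 < n)%N -> coprime m n ->
    A (m * n)%N = [set (d * e)%N | d in A m & e in A n];
  regular_pfactor : forall p a : nat, prime p -> (0 < a)%N ->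
    exists2 t : nat, (t %| a)%N &
      forall i : nat, (i <= a %/ t)%N ->
        A (p ^ (i * t))%N = [set (p ^ (k * t))%N | k in [set k | (k <= i)%N]]
}.

(* (j, n)_A; for n > 0 every element of A n occurs in divisors n. *)
Definition gcdA (A : nat -> set nat) (j : int) (n : nat) : nat :=
  \max_(d <- divisors n | (d \in A n) && (d%:Z %| j)%Z) d.

(* e ^ (2 i pi / n) *)
Definition zeta (R : realType) (n : nat) : R[i] :=
  cos (2 * pi / n%:R) +i* sin (2 * pi / n%:R).

Definition PhiA (R : realType) (A : nat -> set nat) (n : nat) : {poly R[i]} :=
  \prod_(1 <= j < n.+1 | gcdA A j%:Z n == 1%N) ('X - (zeta R n ^+ j)%:P).

(* chi 1 = 1 follows from the first and the last fields. *)
Record dirichlet_character (R : realType) (n : nat) (chi : int -> R[i]) : Prop :=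
  DirichletCharacter {
    dirichlet_mul : forall a b : int, chi (a * b) = chi a * chi b;
    dirichlet_periodic : forall a : int, chi (a + n%:Z) = chi a;
    dirichlet_neq0 : forall a : int, (chi a != 0) = coprimez a n%:Z
}.

Definition induced_modulus (R : realType) (n : nat) (chi : int -> R[i])
    (d : nat) : Prop :=
  (d %| n)%N /\
  exists2 psi : int -> R[i], dirichlet_character d psi &
    forall a : int, coprimez a n%:Z -> chi a = psi a.

Definition is_conductor (R : realType) (n : nat) (chi : int -> R[i])
    (d : nat) : Prop :=
  induced_modulus n chi d /\
  forall d' : nat, induced_modulus n chi d' -> (d <= d')%N.

Definition primitive_character (R : realType) (n : nat) (chi : int -> R[i]) :
    Prop :=
  dirichlet_character n chi /\ is_conductor n chi n.

(* Main.v *)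
Require Import Defs.
From HB Require Import structures.
From mathcomp Require Import all_boot all_order all_algebra.
From mathcomp Require Import ring lra.
From mathcomp Require Import complex.
From mathcomp Require Import all_classical all_reals all_analysis.

Set Implicit Arguments.
Unset Strict Implicit.
Unset Printing Implicit Defensive.

Import Order.TTheory GRing.Theory Num.Theory.

Local Open Scope classical_set_scope.
Local Open Scope ring_scope.
Local Open Scope complex_scope.

(** In terms of exponents, [e] lies in [A n] iff [e] divides [n] and, for every
    prime [p], the valuation of [e] at [p] is a multiple of [t_A(p^a)], where [a]
    is the valuation of [n] at [p]. Sorting the [n]-th roots of unity [zeta_n^j]
    by [(j, n)_A] then gives [x^n - 1 = \prod_(e in A n) Phi_(A, e)(x)], and an
    element of [A n] divides [j - 1] iff it lies in [A ((j - 1, n)_A)]. Hence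
    the exponent of [Phi_(A, e)(x)] in the left-hand side is the sum of
    [Re (chi j)] over [j = 1 mod e]. This is a sum of [chi] over the kernel of
    the surjection [(Z/n)^* -> (Z/e)^*]: it equals [phi(n)/phi(e)] if the
    conductor divides [e], and vanishes otherwise. *)

(** * Regular systems of divisors *)

(* [T p a] is the paper's [t_A(p^a)]. *)
Record exponent_type (A : nat -> set nat) (T : nat -> nat -> nat) : Prop :=
  ExponentType {
    exponent_dvd : forall p a : nat, prime p -> (T p a %| a)%N;
    exponent_stable : forall p a k : nat, prime p -> (0 < k <= a)%N ->
      (T p a %| k)%N -> T p k = T p a;
    exponent_mem : forall n d : nat, (0 < n)%N ->
      A n d <-> (d %| n)%N /\
        forall p, prime p -> (T p (logn p n) %| logn p d)%N
  }.

(** [T p a] is chosen among the [t] of the prime-power condition. Stability holds because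
    [A (p ^ k)] is then described both by [T p a] and by [T p k], so each divides the other.
    Membership for general [n] is assembled one prime at a time from multiplicativity. *)
Lemma regular_exponent_type (A : nat -> set nat) :
  regular_system A -> exists T, exponent_type A T.
Proof.
case=> Advd A1 Amul Ap.
pose Q (p a t : nat) := prime p -> (0 < a)%N -> (t %| a)%N /\
      forall i : nat, (i <= a %/ t)%N ->
        A (p ^ (i * t))%N = [set (p ^ (k * t))%N | k in [set k | (k <= i)%N]].
(* [Q] is vacuous unless [p] is prime and [a] is positive; elsewhere any value serves. *)
have /choice[T0 T0P] (pa : nat * nat) : exists t, Q pa.1 pa.2 t.
  case: pa => p a; rewrite /Q /=.
  have [p_pr|] := boolP (prime p); last by exists 0%N.
  have [->|a_gt0] := posnP a; first by exists 0%N.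
  by have [t ta tP] := Ap p a p_pr a_gt0; exists t.
pose T p a := T0 (p, a).
have {}T0P p a : Q p a (T p a) by exact: (T0P (p, a)).
have Tdvd p a : prime p -> (T p a %| a)%N.
  by have [-> //|a_gt0 p_pr] := posnP a; have [] := T0P p a p_pr a_gt0.
have Amem p a k : prime p -> (0 < a)%N ->
    A (p ^ a)%N (p ^ k)%N <-> (k <= a)%N /\ (T p a %| k)%N.
  (* The largest admissible index, [a %/ t], gives the exponent [a] itself. *)
  move=> p_pr a_gt0; have [ta /(_ _ (leqnn _))] := T0P p a p_pr a_gt0.
  rewrite divnK // => ->; split => [[i /= ile] /(expnI (prime_gt1 p_pr)) <-|].
    rewrite dvdn_mull //; split => //.
    by rewrite -[leqRHS](divnK ta) leq_mul2r ile orbT.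
  move=> [ka tk]; exists (k %/ T p a)%N; last by rewrite divnK.
  by rewrite /= leq_div2r.
exists T; split => //.
- move=> p a k p_pr /andP[k_gt0 ka] tk.
  have a_gt0 := leq_trans k_gt0 ka.
  (* Since [T p a] divides [k], the condition for [p ^ a] at index [k %/ T p a] already describes
     [A (p ^ k)]. *)
  have AkE : A (p ^ k)%N =
      [set (p ^ (i * T p a))%N | i in [set i | (i <= k %/ T p a)%N]].
    have [_ /(_ (k %/ T p a)%N)] := T0P p a p_pr a_gt0.
    by rewrite divnK //; apply; rewrite leq_div2r.
  have t_gt0 : (0 < T p a)%N by apply: dvdn_gt0 tk.
  have s_gt0 : (0 < T p k)%N by apply: dvdn_gt0 (Tdvd p k p_pr).
  apply/eqP; rewrite eqn_dvd; apply/andP; split.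
    have /(Amem p k _ p_pr k_gt0)[] // : A (p ^ k)%N (p ^ T p a)%N.
    rewrite AkE; exists 1%N; last by rewrite mul1n.
    by rewrite /= divn_gt0 // dvdn_leq.
  have : A (p ^ k)%N (p ^ T p k)%N.
    by apply/Amem => //; split => //; rewrite dvdn_leq // Tdvd.
  by rewrite AkE => -[i _ /(expnI (prime_gt1 p_pr)) <-]; rewrite dvdn_mull.
elim/ltn_ind => n IHn d n_gt0.
have [n_le1|n_gt1] := leqP n 1%N.
  have -> : n = 1%N by case: (n) n_gt0 n_le1 => [|[]].
  rewrite A1 dvdn1; split => [->|[/eqP -> //]].
  by split=> // p _; rewrite logn1 dvdn0.
(* The full power of the least prime factor is split off; the cofactor [m] is coprime to it and
   smaller than [n]. *)
have p_pr := pdiv_prime n_gt1; set p := pdiv n in p_pr.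
have [m pm nE] := pfactor_coprime p_pr n_gt0.
set a := logn p n in nE.
have a_gt0 : (0 < a)%N by rewrite logn_gt0 mem_primes p_pr n_gt0 pdiv_dvd.
have m_gt0 : (0 < m)%N by move: n_gt0; rewrite nE muln_gt0 => /andP[].
have pa_gt0 : (0 < p ^ a)%N by rewrite expn_gt0 prime_gt0.
have m_lt : (m < n)%N.
  by rewrite {1}nE ltn_Pmulr // -{1}(exp1n a) ltn_exp2r // prime_gt1.
have pma : coprime m (p ^ a) by rewrite coprime_sym coprimeXl.
rewrite nE (Amul _ _ m_gt0 pa_gt0 pma).
have lognn q u k : prime q -> (0 < u)%N ->
    logn q (u * p ^ k)%N = (logn q u + k * (q == p))%N.
  have pk_gt0 : (0 < p ^ k)%N by rewrite expn_gt0 prime_gt0.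
  move=> q_pr u_gt0; rewrite lognM // lognX.
  by rewrite (logn_prime _ p_pr).
split=> [[u /(IHn m m_lt u m_gt0)[um uT] [v]]|[dvd_d dT]].
  have [ta /(_ _ (leqnn _))] := T0P p a p_pr a_gt0.
  rewrite divnK // => -> [k /= ka <- <-].
  have u_gt0 := dvdn_gt0 m_gt0 um.
  have ka' : (k * T p a <= a)%N by rewrite -[leqRHS](divnK ta) leq_mul2r ka orbT.
  split=> [|q q_pr]; first by rewrite dvdn_mul // dvdn_exp2l.
  rewrite !lognn //; have [->|_] := eqVneq q p; last by rewrite !muln0 !addn0 uT.
  rewrite !muln1 (logn_coprime pm) add0n.
  have -> : logn p u = 0%N by apply: logn_coprime; exact: coprime_dvdr um pm.
  by rewrite add0n dvdn_mull.
have d_gt0 : (0 < d)%N by apply: dvdn_gt0 dvd_d; rewrite -nE.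
have [u pu dE] := pfactor_coprime p_pr d_gt0.
have u_gt0 : (0 < u)%N by move: d_gt0; rewrite dE muln_gt0 => /andP[].
exists u.
  apply/(IHn m m_lt u m_gt0); split.
    rewrite -(@Gauss_dvdl _ _ (p ^ a)) ?coprimeXr // 1?coprime_sym //.
    by apply: dvdn_trans dvd_d; rewrite dE dvdn_mulr.
  move=> q q_pr; have := dT q q_pr; rewrite lognn // {1}dE lognn //.
  have [->|_] := eqVneq q p; last by rewrite !muln0 !addn0.
  by rewrite (logn_coprime pu).
exists (p ^ logn p d)%N => //.
apply/Amem => //; split; last first.
  by have := dT p p_pr; rewrite lognn // eqxx muln1 (logn_coprime pm).
have -> : a = logn p (m * p ^ a)%N.
  by rewrite lognn // eqxx muln1 (logn_coprime pm).
by apply: dvdn_leq_log => //; rewrite -nE.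
Qed.

Section RegularSystemTheory.

Variables (A : nat -> set nat) (hA : regular_system A).

Lemma regular_gt0 (n d : nat) : (0 < n)%N -> A n d -> (0 < d)%N.
Proof. by move=> n_gt0 /(regular_dvd hA n_gt0); apply: dvdn_gt0. Qed.

Lemma regular_id (n : nat) : (0 < n)%N -> A n n.
Proof.
have [T hT] := regular_exponent_type hA => n_gt0.
by apply/(exponent_mem hT _ n_gt0); split=> // p /(exponent_dvd hT).
Qed.

Lemma regular_has1 (n : nat) : (0 < n)%N -> A n 1%N.
Proof.
have [T hT] := regular_exponent_type hA => n_gt0.
by apply/(exponent_mem hT _ n_gt0); split=> // p _; rewrite logn1 dvdn0.
Qed.

(** At each prime the valuation of the lcm is one of the two given valuations. *)
Lemma regular_lcm (n d e : nat) :
  (0 < n)%N -> A n d -> A n e -> A n (lcmn d e).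
Proof.
have [T hT] := regular_exponent_type hA => n_gt0 And Ane.
have [d_gt0 e_gt0] := (regular_gt0 n_gt0 And, regular_gt0 n_gt0 Ane).
move: And Ane => /(exponent_mem hT _ n_gt0)[dn dT].
move=> /(exponent_mem hT _ n_gt0)[en eT].
apply/(exponent_mem hT _ n_gt0); split; first by rewrite dvdn_lcm dn.
by move=> p p_pr; rewrite logn_lcm // /maxn; case: ifP => _; auto.
Qed.

(** By stability, [e] and [n] have the same type at every prime dividing [e]; at the other primes
    [f] has valuation 0 and both conditions are trivial. *)
Lemma regular_divisor (n e f : nat) :
  (0 < n)%N -> A n e -> A e f <-> A n f /\ (f %| e)%N.
Proof.
have [T hT] := regular_exponent_type hA => n_gt0 Ane.
have e_gt0 := regular_gt0 n_gt0 Ane.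
move: Ane => /(exponent_mem hT _ n_gt0)[en eT].
have Teq p : prime p -> (f %| e)%N ->
    (T p (logn p e) %| logn p f)%N = (T p (logn p n) %| logn p f)%N.
  move=> p_pr fe; have [e0|e_gt] := posnP (logn p e).
    have : (logn p f <= logn p e)%N by apply: dvdn_leq_log.
    by rewrite e0 leqn0 => /eqP ->; rewrite !dvdn0.
  by rewrite (exponent_stable hT p_pr _ (eT p p_pr)) // e_gt dvdn_leq_log.
split=> [/(exponent_mem hT _ e_gt0)[fe fT]|].
  split=> //; apply/(exponent_mem hT _ n_gt0).
  split=> [|p p_pr]; first exact: dvdn_trans fe en.
  by rewrite -Teq // fT.
move=> [/(exponent_mem hT _ n_gt0)[_ fT] fe].
apply/(exponent_mem hT _ e_gt0); split=> // p p_pr.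
by rewrite Teq // fT.
Qed.

Lemma regular_divn (n e : nat) : (0 < n)%N -> A n e -> A n (n %/ e)%N.
Proof.
have [T hT] := regular_exponent_type hA => n_gt0.
move=> /(exponent_mem hT _ n_gt0)[en eT].
apply/(exponent_mem hT _ n_gt0); split=> [|p p_pr]; first exact: dvdn_div.
by rewrite logn_div // dvdn_sub // ?(exponent_dvd hT) // eT.
Qed.

(** The valuation of [n %/ e] at [p] is a multiple of the type of [n] at [p], so stability gives
    both numbers the same type wherever that valuation is positive. *)
Lemma regular_quotient (n e h : nat) :
  (0 < n)%N -> A n e -> A (n %/ e)%N h <-> A n (e * h)%N.
Proof.
have [T hT] := regular_exponent_type hA => n_gt0 Ane.
have e_gt0 := regular_gt0 n_gt0 Ane.
move: (Ane) => /(exponent_mem hT _ n_gt0)[en eT].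
have ne_gt0 : (0 < n %/ e)%N by rewrite divn_gt0 // dvdn_leq.
have dvdE : (e * h %| n)%N = (h %| n %/ e)%N.
  by rewrite -{1}(divnK en) mulnC dvdn_pmul2r.
have Teq p : prime p -> (h %| n %/ e)%N ->
    (T p (logn p (n %/ e)) %| logn p h)%N = (T p (logn p n) %| logn p (e * h))%N.
  move=> p_pr hne; have h_gt0 := dvdn_gt0 ne_gt0 hne.
  rewrite lognM // dvdn_addr ?eT //.
  have := dvdn_leq_log p ne_gt0 hne; rewrite logn_div // => hle.
  have [e0|e_gt] := posnP (logn p n - logn p e).
    by move: hle; rewrite e0 leqn0 => /eqP ->; rewrite !dvdn0.
  rewrite (exponent_stable hT p_pr (a := logn p n)) ?e_gt ?leq_subr //.
  by rewrite dvdn_sub // ?(exponent_dvd hT) ?eT.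
split=> [/(exponent_mem hT _ ne_gt0)[hne heT]|].
  apply/(exponent_mem hT _ n_gt0).
  split=> [|p p_pr]; first by rewrite dvdE.
  by rewrite -Teq // heT.
move=> /(exponent_mem hT _ n_gt0)[]; rewrite dvdE => hne heT.
apply/(exponent_mem hT _ ne_gt0); split=> // p p_pr.
by rewrite Teq // heT.
Qed.

Lemma leq_gcdA (j : int) (n e : nat) :
  (0 < n)%N -> A n e -> (e%:Z %| j)%Z -> (e <= gcdA A j n)%N.
Proof.
move=> n_gt0 Ane ej; apply: (leq_bigmax_seq (F := id)).
  by rewrite -dvdn_divisors // (regular_dvd hA).
by rewrite ej andbT inE.
Qed.

Lemma gcdA_gt0 (j : int) (n : nat) : (0 < n)%N -> (0 < gcdA A j n)%N.
Proof.
by move=> n_gt0; apply: leq_gcdA; rewrite ?dvd1z //; apply: regular_has1.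
Qed.

Lemma gcdA_spec (j : int) (n : nat) : (0 < n)%N ->
  A n (gcdA A j n) /\ ((gcdA A j n)%:Z %| j)%Z.
Proof.
(* The induction carries the hypothesis that the maximum is nonzero, which discards the default
   value 0 of an empty maximum. *)
move=> n_gt0; have := gcdA_gt0 j n_gt0; rewrite lt0n /gcdA.
elim/big_ind: _ => // [x y Px Py|d /andP[]]; last by rewrite inE.
by rewrite /maxn; case: ifP.
Qed.

(** The maximum is also greatest for divisibility: if [e] in [A n] divides [j], then the lcm of [e]
    and [(j, n)_A] lies in [A n] and divides [j], so it cannot exceed [(j, n)_A]. *)
Lemma regular_gcdA (j : int) (n e : nat) : (0 < n)%N ->
  A (gcdA A j n) e <-> A n e /\ (e%:Z %| j)%Z.
Proof.
move=> n_gt0; have [Ang gj] := gcdA_spec j n_gt0.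
set g := gcdA A j n in Ang gj *.
rewrite (regular_divisor e n_gt0 Ang); split=> -[Ane].
  by move=> eg; split=> //; apply: dvdz_trans gj.
move=> ej; split=> //.
have g_gt0 := regular_gt0 n_gt0 Ang.
have e_gt0 := regular_gt0 n_gt0 Ane.
have : (lcmn e g <= g)%N.
  apply: leq_gcdA => //; first exact: regular_lcm.
  by move: ej gj; rewrite !dvdzE /= dvdn_lcm => -> ->.
have := dvdn_lcmr e g; move/dvdn_leq => /(_ _) le1 le2.
have -> : g = lcmn e g by apply/eqP; rewrite eqn_leq le2 le1 // lcmn_gt0 e_gt0.
exact: dvdn_lcml.
Qed.

(** By [regular_quotient], multiplication by [e] matches [A (n %/ e)] with the multiples of [e] in
    [A n]. This is what identifies the roots of unity with a prescribed [(j, n)_A]. *)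
Lemma gcdA_mul_eq (n e j : nat) : (0 < n)%N -> A n e ->
  (gcdA A (e * j)%N%:Z n == e) = (gcdA A j%:Z (n %/ e) == 1%N).
Proof.
move=> n_gt0 Ane; have e_gt0 := regular_gt0 n_gt0 Ane.
have ne_gt0 : (0 < n %/ e)%N.
  by rewrite divn_gt0 // dvdn_leq // (regular_dvd hA).
apply/eqP/eqP => [gE|gE].
  have [Ag gj] := gcdA_spec j%:Z ne_gt0.
  set g := gcdA A _ _ in Ag gj *.
  have : (e * g <= e)%N.
    rewrite -{2}gE; apply: leq_gcdA => //; first exact/regular_quotient.
    by rewrite dvdzE /= dvdn_pmul2l.
  rewrite -{2}(muln1 e) leq_pmul2l // => g_le1.
  by apply/eqP; rewrite eqn_leq g_le1 (regular_gt0 ne_gt0 Ag).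
have [Ag gj] := gcdA_spec (e * j)%N%:Z n_gt0.
set g := gcdA A _ n in Ag gj *.
have eg : (e %| g)%N.
  have : A g e by apply/regular_gcdA => //; split=> //; rewrite dvdzE /= dvdn_mulr.
  by apply: (regular_dvd hA); apply: regular_gt0 Ag.
have [h gE'] := dvdnP eg; rewrite mulnC in gE'.
have : (h <= 1)%N.
  rewrite -gE; apply: leq_gcdA => //.
    by apply/regular_quotient => //; rewrite -gE'.
  by move: gj; rewrite gE' !dvdzE /= dvdn_pmul2l.
have : (0 < g)%N by exact: regular_gt0 Ag.
by rewrite gE'; case: h {gE'} => [|[|h]]; rewrite ?muln0 ?muln1.
Qed.

End RegularSystemTheory.

(** * The cyclotomic factorization *)

Lemma divn_divn (n g : nat) : (0 < n)%N -> (g %| n)%N -> (n %/ (n %/ g) = g)%N.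
Proof.
move=> n_gt0 gn; rewrite -{1}(divnK gn) mulKn //.
by rewrite divn_gt0 ?(dvdn_gt0 n_gt0) // dvdn_leq.
Qed.

Lemma big_divisors_inv (V : Type) (idx : V) (op : Monoid.com_law idx)
    (n : nat) (P : pred nat) (F : nat -> V) : (0 < n)%N ->
  \big[op/idx]_(e <- divisors n | P e) F e =
  \big[op/idx]_(g <- divisors n | P (n %/ g)%N) F (n %/ g)%N.
Proof.
move=> n_gt0; rewrite (perm_big [seq (n %/ g)%N | g <- divisors n]).
  by rewrite big_map.
apply: uniq_perm; rewrite ?divisors_uniq //.
  rewrite map_inj_in_uniq ?divisors_uniq // => a b.
  rewrite -!dvdn_divisors // => an bn e.
  by rewrite -(divn_divn _ an) // e divn_divn.
move=> g; rewrite -dvdn_divisors //; apply/idP/mapP => [gn|[h]].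
  by exists (n %/ g)%N; rewrite ?divn_divn // -dvdn_divisors // dvdn_div.
by rewrite -dvdn_divisors // => hn ->; rewrite dvdn_div.
Qed.

Section Cyclotomic.

Variable R : realType.

Lemma expr_cos_sin (a : R) (k : nat) :
  (cos a +i* sin a) ^+ k = cos (a *+ k) +i* sin (a *+ k).
Proof.
elim: k => [|k IHk]; first by rewrite expr0 mulr0n cos0 sin0.
rewrite exprS IHk mulrS cosD sinD; apply/eqP.
by rewrite eq_complex /= eqxx /= addrC (mulrC (cos a)).
Qed.

Lemma zeta_mul (m g : nat) : (0 < g)%N -> zeta R (g * m) ^+ g = zeta R m.
Proof.
move=> g_gt0; have g_neq0 : g%:R != 0 :> R by rewrite pnatr_eq0 -lt0n.
rewrite expr_cos_sin -(mulr_natr (_ / _) g) natrM invfM.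
by rewrite (mulrA (2 * pi)) mulrAC divfK.
Qed.

Lemma zeta_primitive (n : nat) : (0 < n)%N -> n.-primitive_root (zeta R n).
Proof.
move=> n_gt0; have n_gt0' : 0 < n%:R :> R by rewrite ltr0n.
apply/andP; split=> //; apply/forallP => -[k /= k_lt]; apply/eqP.
rewrite unity_rootE expr_cos_sin; have [->|k_neq] := eqVneq k.+1 n.
  rewrite -(mulr_natr (_ / _) n) (divfK (lt0r_neq0 n_gt0')).
  by rewrite mulr_natl cos2pi sin2pi eqxx.
(* [b] is half the argument of [zeta R n ^+ k.+1]. It lies strictly between 0 and [pi], so the real
   part [1 - 2 sin^2 b] of that power is less than 1. *)
pose b : R := pi * k.+1%:R / n%:R.
have -> : 2 * pi / n%:R *+ k.+1 = b *+ 2.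
  by rewrite -(mulr_natr (_ / _) k.+1) mulrAC -(mulr_natl b) /b !mulrA.
have b_lt : 0 < b < pi.
  rewrite /b divr_gt0 ?mulr_gt0 ?pi_gt0 ?ltr0n //=.
  rewrite ltr_pdivrMr // ltr_pM2l ?pi_gt0 // ltr_nat ltn_neqAle k_neq.
  exact: k_lt.
apply/negbTE; rewrite eq_complex /= negb_and; apply/orP; left.
rewrite cos_mulr2n cos2sin2 lt_eqF //.
have : 0 < sin b ^+ 2 by rewrite exprn_gt0 // sin_gt0_pi.
lra.
Qed.

Variables (A : nat -> set nat) (hA : regular_system A).

(** Each such [j] is some [g * k]; then [zeta_n^j = zeta_(n/g)^k], and [gcdA_mul_eq] turns the
    condition on [j] into the one defining [PhiA] at [n %/ g]. *)
Lemma prod_coprimeA (n g : nat) : (0 < n)%N -> A n g ->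
  \prod_(1 <= j < n.+1 | gcdA A j%:Z n == g) ('X - (zeta R n ^+ j)%:P) =
  PhiA R A (n %/ g).
Proof.
move=> n_gt0 Ang; have g_gt0 := regular_gt0 hA n_gt0 Ang.
have nE : n = (g * (n %/ g))%N by rewrite mulnC divnK // (regular_dvd hA).
rewrite /PhiA -big_filter -[RHS]big_filter.
rewrite (perm_big [seq (g * k)%N | k <- index_iota 1 (n %/ g).+1
    & gcdA A k%:Z (n %/ g) == 1%N]).
  rewrite big_map; apply: eq_bigr => k _.
  by rewrite exprM [in zeta R n]nE zeta_mul.
apply: uniq_perm.
- by rewrite filter_uniq // iota_uniq.
- rewrite map_inj_uniq ?filter_uniq ?iota_uniq // => x y /eqP.
  by rewrite eqn_pmul2l // => /eqP.
move=> j; rewrite mem_filter mem_index_iota; apply/andP/mapP.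
  move=> [/eqP gE /andP[j_gt0 jn]].
  have [_] := gcdA_spec hA j%:Z n_gt0; rewrite gE dvdzE /= => /dvdnP[k jE].
  rewrite mulnC in jE; exists k => //.
  rewrite mem_filter mem_index_iota -gcdA_mul_eq // -jE gE eqxx /=.
  move: j_gt0 jn; rewrite jE muln_gt0 => /andP[_ ->] /=.
  by rewrite !ltnS {1}nE leq_pmul2l.
move=> [k]; rewrite mem_filter mem_index_iota -gcdA_mul_eq //.
move=> /and3P[gE k_gt0 kn] ->.
by split=> //; rewrite muln_gt0 g_gt0 k_gt0 ltnS [leqRHS]nE leq_pmul2l //.
Qed.

Lemma prod_PhiA (n : nat) : (0 < n)%N ->
  \prod_(e <- divisors n | e \in A n) PhiA R A e = 'X^n - 1.
Proof.
move=> n_gt0; have zP := zeta_primitive n_gt0.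
rewrite -(factor_Xn_sub_1 zP).
(* Starting at 1 instead of 0 is harmless, since the exponents [n] and 0 both give the root 1. *)
transitivity (\prod_(1 <= j < n.+1) ('X - (zeta R n ^+ j)%:P)); last first.
  case: n n_gt0 zP => // k _ zP; rewrite [RHS]big_ltn // [LHS]big_nat_recr //=.
  by rewrite mulrC expr0 (prim_expr_order zP).
(* Each factor becomes a product over the single divisor [g = (j, n)_A], so that exchanging the
   products groups the roots by [g]. *)
rewrite (eq_bigr (fun j => \prod_(g <- divisors n | gcdA A j%:Z n == g)
    ('X - (zeta R n ^+ j)%:P))); last first.
  move=> j _; rewrite -big_filter.
  have [Ag _] := gcdA_spec hA j%:Z n_gt0.
  have := filter_pred1_uniq (divisors_uniq n) (x := gcdA A j%:Z n).
  rewrite -dvdn_divisors // (regular_dvd hA) // => /(_ isT) fE.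
  have -> : [seq g <- divisors n | gcdA A j%:Z n == g] = [:: gcdA A j%:Z n].
    by rewrite -fE; apply: eq_filter => g; rewrite eq_sym.
  by rewrite big_seq1.
rewrite (exchange_big_dep (fun g => g \in A n)) /=; last first.
  by move=> j g _ /eqP <-; rewrite inE; case: (gcdA_spec hA j%:Z n_gt0).
rewrite [LHS](big_divisors_inv _ _ _ n_gt0) [LHS]big_seq_cond [RHS]big_seq_cond.
(* [A n] is stable under the involution [g -> n / g]. *)
have AE g : (g \in divisors n) && ((n %/ g)%N \in A n) =
            (g \in divisors n) && (g \in A n).
  have [/=|//] := boolP (g \in divisors n); rewrite -dvdn_divisors // => gn.
  apply/idP/idP; rewrite !inE; last exact: regular_divn.
  by move/(regular_divn hA n_gt0); rewrite divn_divn.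
apply: eq_big => [|g]; first exact: AE.
rewrite AE => /andP[_]; rewrite inE => Ang; symmetry; exact: prod_coprimeA.
Qed.

(** Strong induction on [prod_PhiA]: [x^n - 1] is positive, and so are the factors at the proper
    divisors in [A n], hence the remaining factor is real and positive too. *)
Lemma PhiA_gt0 (x : R) (n : nat) : 1 < x -> (0 < n)%N ->
  exists2 y : R, 0 < y & (PhiA R A n).[x%:C] = y%:C.
Proof.
move=> x_gt1; elim/ltn_ind: n => n IHn n_gt0.
have prodE : (PhiA R A n).[x%:C] *
    \prod_(e <- rem n (divisors n) | e \in A n) (PhiA R A e).[x%:C] =
    (x ^+ n - 1)%:C.
  transitivity (('X^n - 1 : {poly R[i]}).[x%:C]); last first.
    by rewrite !hornerE rmorphB rmorphXn rmorph1.
  have nA : n \in A n by rewrite inE; exact: regular_id.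
  rewrite -(prod_PhiA n_gt0) [in RHS](big_rem n (divisors_id n_gt0)) /= nA.
  by rewrite hornerM; congr (_ * _); symmetry; exact: horner_prod.
have [z z_gt0 zE] : exists2 z : R, 0 < z &
    \prod_(e <- rem n (divisors n) | e \in A n) (PhiA R A e).[x%:C] = z%:C.
  rewrite big_seq_cond; elim/big_ind: _ => [|u v [y y_gt0 ->] [z z_gt0 ->]|e].
  - by exists 1.
  - by exists (y * z); rewrite ?mulr_gt0 // rmorphM.
  rewrite mem_rem_uniq ?divisors_uniq // inE -dvdn_divisors //.
  move=> /andP[/andP[e_neq en] _]; apply: IHn; last exact: dvdn_gt0 en.
  by rewrite ltn_neqAle e_neq dvdn_leq.
have z_neq0 : z%:C != 0.
  by rewrite -(rmorph0 (real_complex R)) (inj_eq (@complexI _)) gt_eqF.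
exists ((x ^+ n - 1) / z).
  by rewrite divr_gt0 // subr_gt0 exprn_egt1 // -lt0n.
by apply: (mulIf z_neq0); rewrite -{1}zE prodE -rmorphM divfK ?gt_eqF.
Qed.

End Cyclotomic.

(** * Character sums over the residues congruent to 1 *)

Lemma eqn_modMl (e b x y : nat) : coprime e b ->
  (b * x == b * y %[mod e]) = (x == y %[mod e]).
Proof.
move=> eb; wlog le_yx : x y / (y <= x)%N.
  move=> W; have [|/ltnW le_xy] := leqP y x; first exact: W.
  by rewrite eq_sym [RHS]eq_sym W.
by rewrite !eqn_mod_dvd ?leq_mul2l ?le_yx ?orbT // -mulnBr Gauss_dvdr.
Qed.

Section PeriodicBigop.

Variables (V : Type) (idx : V) (op : Monoid.com_law idx) (n : nat).
Variable F : nat -> V.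
Hypothesis Fmod : forall j, F (j %% n)%N = F j.

Lemma big_period_shift : (0 < n)%N ->
  \big[op/idx]_(1 <= j < n.+1) F j = \big[op/idx]_(0 <= j < n) F j.
Proof.
case: n Fmod => // k Fk _; rewrite [RHS]big_ltn // [LHS]big_nat_recr //=.
by rewrite Monoid.mulmC -(Fk k.+1) modnn.
Qed.

(** Multiplication by a unit permutes the residues mod [n]. *)
Lemma big_period_mul (c : nat) : (0 < n)%N -> coprime n c ->
  \big[op/idx]_(0 <= j < n) F j = \big[op/idx]_(0 <= j < n) F (c * j)%N.
Proof.
move=> n_gt0 nc; rewrite !big_mkord.
pose h (i : 'I_n) := Ordinal (ltn_pmod (c * i) n_gt0).
have h_inj : injective h.
  move=> x y /(congr1 val)/= /eqP; rewrite eqn_modMl // !modn_small // => /eqP.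
  exact: val_inj.
by rewrite (reindex_inj h_inj); apply: eq_bigr => i _; rewrite /= Fmod.
Qed.

End PeriodicBigop.

(** By the Chinese remainder theorem, prescribe [a] mod [e] and 1 mod [m], the part of [n] prime to
    [e]: every prime factor of [n] divides [e] or [m]. Divisibility of [n] by [e] is not assumed,
    which later allows the modulus [d * e]. *)
Lemma coprime_lift (n e a : nat) : (0 < n)%N -> (0 < e)%N -> coprime e a ->
  exists2 b, coprime n b & b = a %[mod e].
Proof.
move=> n_gt0 e_gt0 ea; pose m := (n`_(\pi(e)^'))%N.
have m_gt0 : (0 < m)%N by exact: part_gt0.
have em : coprime e m by rewrite coprime_pi' // part_pnat.
(* The summand [e * m] leaves both residues unchanged and makes [b] positive. *)
pose b := (chinese e m a 1 + e * m)%N.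
have b_gt0 : (0 < b)%N by rewrite addn_gt0 muln_gt0 e_gt0 m_gt0 orbT.
have be : b = a %[mod e] by rewrite /b addnC mulnC modnMDl chinese_modl.
have bm : b = 1 %[mod m] by rewrite /b addnC modnMDl chinese_modr.
exists b => //; rewrite -(partnC \pi(e) n_gt0) coprimeMl; apply/andP; split.
  apply: (@pnat_coprime \pi(e)); first exact: part_pnat.
  by rewrite -coprime_pi' // -coprime_modr be coprime_modr.
by rewrite -coprime_modr bm coprime_modr coprimen1.
Qed.

(** The units mod [n] are sorted by their residue [a] mod [e]. Multiplication by a lift of [a]
    carries the fibre over 1 onto the fibre over [a], so all fibres over units have the same
    size. *)
Lemma totient_count_mod1 (n e : nat) : (0 < n)%N -> (e %| n)%N ->
  (totient e * \sum_(0 <= j < n | j == 1 %[mod e]) coprime n j)%N = totient n.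
Proof.
move=> n_gt0 en; have e_gt0 := dvdn_gt0 n_gt0 en.
rewrite [totient n]totient_count_coprime.
rewrite [RHS](eq_bigr (fun j =>
  \sum_(0 <= a < e | j == a %[mod e]) coprime n j)%N); last first.
  move=> j _; have je : (j %% e < e)%N by rewrite ltn_pmod.
  rewrite -big_filter.
  rewrite (eq_in_filter (a2 := pred1 (j %% e)%N)).
    by rewrite filter_pred1_uniq ?iota_uniq ?big_seq1 // mem_index_iota.
  move=> a; rewrite mem_index_iota => /= ae.
  by rewrite (modn_small ae) eq_sym.
rewrite (exchange_big_dep xpredT) //= totient_count_coprime big_distrl /=.
apply: eq_bigr => a _; have [ea|nea] := boolP (coprime e a); last first.
  (* A class that is not coprime to [e] contains nothing coprime to [n]. *)
  rewrite mul0n big1 // => j /eqP ja; case nj : coprime => //.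
  by move: nea; rewrite -coprime_modr -ja coprime_modr (coprime_dvdl en nj).
have [b nb ba] := coprime_lift n_gt0 e_gt0 ea.
rewrite mul1n big_mkcond [RHS]big_mkcond /= [RHS](big_period_mul _ _ n_gt0 nb).
  apply: eq_bigr => j _; rewrite coprimeMr nb /=.
  congr (if _ then _ else _).
  by rewrite -ba -{2}[b]muln1 eqn_modMl // (coprime_dvdl en nb).
by move=> j; rewrite modn_dvdm // coprime_modr.
Qed.

Lemma coprimez_congr (m : nat) (a b : int) :
  (m%:Z %| a - b)%Z -> coprimez a m = coprimez b m.
Proof.
suff W x y : (m%:Z %| x - y)%Z -> coprimez x m -> coprimez y m.
  move=> mab; apply/idP/idP; apply: W => //.
  by rewrite -opprB dvdzE abszN -dvdzE.
move=> /dvdzP[k xy] /coprimezP[[u v] /= uv]; apply/coprimezP.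
exists (u, u * k + v) => /=; rewrite -uv mulrDl -mulrA -xy.
by ring.
Qed.

Lemma coprimez_lift (n e : nat) (a : int) : (0 < n)%N -> (0 < e)%N ->
  coprimez a e -> exists2 b : nat, coprimez b n & (e%:Z %| b%:Z - a)%Z.
Proof.
move=> n_gt0 e_gt0 ae; have e_neq0 : e%:Z != 0 by rewrite -lt0n.
pose a0 := `|(a %% e%:Z)%Z|%N.
have a0E : a0%:Z = (a %% e%:Z)%Z by rewrite gez0_abs // modz_ge0.
have aa0 : (e%:Z %| a - a0%:Z)%Z by rewrite a0E -eqz_mod_dvd modz_mod.
have ea0 : coprime e a0.
  by move: ae; rewrite (coprimez_congr aa0) coprimezE /= coprime_sym.
have [b nb ba] := coprime_lift n_gt0 e_gt0 ea0.
exists b; first by rewrite coprimezE coprime_sym.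
have : (e%:Z %| b%:Z - a0%:Z)%Z by rewrite -eqz_mod_dvd !modz_nat ba.
move=> ba0; have -> : b%:Z - a = (b%:Z - a0%:Z) - (a - a0%:Z) by ring.
by rewrite rpredB.
Qed.

Section Characters.

Variable R : realType.

Section CharacterTheory.

Variables (n : nat) (chi : int -> R[i]).
Hypotheses (n_gt0 : (0 < n)%N) (hchi : dirichlet_character n chi).

Lemma dirichlet_congr (a b : int) : (n%:Z %| a - b)%Z -> chi a = chi b.
Proof.
have Dn x (k : nat) : chi (x + k%:Z * n%:Z) = chi x.
  elim: k => [|k IHk]; first by rewrite mul0r addr0.
  by rewrite -addn1 PoszD mulrDl mul1r addrA (dirichlet_periodic hchi).
move=> /dvdzP[k /(canRL (subrK _)) ->]; rewrite addrC.
case: k => k; first by rewrite Dn.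
rewrite NegzE -[in RHS](subrK (k.+1%:Z * n%:Z) b) Dn.
by rewrite mulNr.
Qed.

Lemma dirichlet1 : chi 1 = 1.
Proof.
have chi1 : chi 1 != 0 by rewrite (dirichlet_neq0 hchi) coprimezE coprime1n.
by apply: (mulfI chi1); rewrite -(dirichlet_mul hchi) !mulr1.
Qed.

Lemma dirichlet_eq0 (a : int) : ~~ coprimez a n -> chi a = 0.
Proof. by rewrite -(dirichlet_neq0 hchi) negbK => /eqP. Qed.

Section Kernel.

Variable e : nat.
Hypotheses (en : (e %| n)%N) (chi_ker : forall c : int, coprimez c n ->
  (e%:Z %| c - 1)%Z -> chi c = 1).

(** With [w] an inverse of [v] mod [n], both [w * u] and [w * v] are units congruent to 1 mod [e],
    so [chi] is 1 on both, and [chi w] cancels. *)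
Lemma dirichlet_kernel_congr (u v : int) : coprimez u n -> coprimez v n ->
  (e%:Z %| u - v)%Z -> chi u = chi v.
Proof.
move=> un vn uv; have /coprimezP[[w k] /= wk] := vn.
have wn : coprimez w n.
  by apply/coprimezP; exists (v, k) => /=; rewrite mulrC.
have ewv : (n%:Z %| w * v - 1)%Z.
  apply/dvdzP; exists (- k).
  by rewrite -wk opprD addrA subrr add0r mulNr.
have chiwv : chi w * chi v = 1.
  by rewrite -(dirichlet_mul hchi) (dirichlet_congr ewv) dirichlet1.
have chiwu : chi w * chi u = 1.
  rewrite -(dirichlet_mul hchi); apply: chi_ker.
    by rewrite coprimezMl wn un.
  have -> : w * u - 1 = w * (u - v) + (w * v - 1) by ring.
  by rewrite rpredD ?dvdz_mull // (dvdz_trans _ ewv) // dvdzE.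
apply: (mulfI (x := chi w)); first by rewrite (dirichlet_neq0 hchi).
by rewrite chiwu chiwv.
Qed.

(** The inducing character sends a unit [a] mod [e] to [chi] of any lift of [a] coprime to [n]; by
    [dirichlet_kernel_congr] the choice of lift does not matter, which yields multiplicativity and
    periodicity. *)
Lemma induced_modulus_kernel : induced_modulus n chi e.
Proof.
have e_gt0 := dvdn_gt0 n_gt0 en; split=> //.
have /choice[l lP] (a : int) : exists b : int, coprimez a e ->
    coprimez b n /\ (e%:Z %| b - a)%Z.
  have [ae|_] := boolP (coprimez a e); last by exists 0.
  by have [b] := coprimez_lift n_gt0 e_gt0 ae; exists b%:Z.
have lE a b : coprimez a e -> coprimez b n -> (e%:Z %| b - a)%Z ->
    chi (l a) = chi b.
  move=> ae bn ba; have [lan la] := lP a ae.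
  apply: dirichlet_kernel_congr => //.
  have -> : l a - b = (l a - a) - (b - a) by ring.
  by rewrite rpredB.
exists (fun a => if coprimez a e then chi (l a) else 0).
- split=> [a b|a|a].
  + rewrite coprimezMl; have [ae|] := boolP (coprimez a e); last by rewrite mul0r.
    have [be|] := boolP (coprimez b e); last by rewrite mulr0.
    have [[lan la] [lbn lb]] := (lP a ae, lP b be).
    rewrite /= -(dirichlet_mul hchi); apply: lE; rewrite ?coprimezMl ?ae ?lan //.
    have -> : l a * l b - a * b = l a * (l b - b) + b * (l a - a) by ring.
    by rewrite rpredD // dvdz_mull.
  + have aeE : coprimez (a + e%:Z) e = coprimez a e.
      by apply: coprimez_congr; rewrite addrAC subrr add0r.
    rewrite aeE; have [ae|//] := boolP (coprimez a e); have [lan la] := lP a ae.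
    apply: lE; rewrite ?aeE // opprD addrA rpredB //.
  + have [ae|] := boolP (coprimez a e); last by rewrite eqxx.
    by have [lan _] := lP a ae; rewrite (dirichlet_neq0 hchi).
move=> a an; have ae : coprimez a e by apply: coprimez_dvdr en an.
by rewrite ae (lE a a) // subrr dvdz0.
Qed.

End Kernel.

End CharacterTheory.

(* If [c = 1] mod [gcd(d, e)], Bezout gives [w = 1] mod [d] with [w = c] mod [e],
   so [chi] is trivial on the classes 1 mod [gcd(d, e)], and the minimality of
   [d] forces [d = gcd(d, e)]. *)
Lemma conductor_dvdn (n : nat) (chi : int -> R[i]) (d e : nat) :
    (0 < n)%N -> dirichlet_character n chi -> is_conductor n chi d ->
    (e %| n)%N ->
    (forall c : int, coprimez c n -> (e%:Z %| c - 1)%Z -> chi c = 1) ->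
  (d %| e)%N.
Proof.
move=> n_gt0 hchi [[dn [psi hpsi chi_psi]] dmin] en ker_e.
have d_gt0 := dvdn_gt0 n_gt0 dn; have e_gt0 := dvdn_gt0 n_gt0 en.
suff /dmin dle : induced_modulus n chi (gcdn d e).
  have -> : d = gcdn d e.
    by apply/eqP; rewrite eqn_leq dle dvdn_leq // dvdn_gcdl.
  exact: dvdn_gcdr.
apply: (induced_modulus_kernel n_gt0 hchi) => [|c cn /dvdzP[k ck]].
  exact: dvdn_trans (dvdn_gcdl d e) dn.
have [u [v uv]] := Bezoutz d e.
have uvE : u * d%:Z + v * e%:Z = (gcdn d e)%:Z by rewrite uv.
pose w := 1 + k * u * d%:Z.
have wc : (e%:Z %| w - c)%Z.
  apply/dvdzP; exists (- (k * v)); rewrite /w.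
  by rewrite (canRL (subrK _) ck) -uvE; ring.
have wd : coprimez w d.
  have -> : coprimez w d = coprimez 1 d.
    by apply: coprimez_congr; rewrite /w addrC addKr dvdz_mull.
  by rewrite coprimezE coprime1n.
have we : coprimez w e.
  by rewrite (coprimez_congr wc); apply: coprimez_dvdr en cn.
have wl : coprimez w (d * e)%N by rewrite PoszM coprimezMr wd.
have de_gt0 : (0 < d * e)%N by rewrite muln_gt0 d_gt0.
(* [w] need not be coprime to [n], so it is replaced by a unit [b] with the same residue mod
   [d * e], hence mod [d] and mod [e]. *)
have [b bn bw] := coprimez_lift n_gt0 de_gt0 wl.
have -> : chi c = chi b.
  apply: (dirichlet_kernel_congr hchi en ker_e) => //.
  have -> : c - b%:Z = - (b%:Z - w) - (w - c) by ring.
  rewrite rpredB // rpredN; apply: dvdz_trans bw.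
  by rewrite dvdzE /= dvdn_mull.
rewrite chi_psi // -(dirichlet1 hpsi); apply: (dirichlet_congr hpsi).
have -> : b%:Z - 1 = (b%:Z - w) + k * u * d%:Z by rewrite /w; ring.
rewrite rpredD ?dvdz_mull //; apply: dvdz_trans bw.
by rewrite dvdzE /= dvdn_mulr.
Qed.

(** If [d] divides [e], each term prime to [n] is 1 and the sum counts the kernel; the quotient of
    totients is exact by [totient_count_mod1]. Otherwise some [c] in the kernel has [chi c != 1],
    and multiplying the indices by [c] multiplies the sum by [chi c]. *)
Lemma dirichlet_sum_mod1 (n : nat) (chi : int -> R[i]) (d e : nat) :
    (0 < n)%N -> dirichlet_character n chi -> is_conductor n chi d ->
    (e %| n)%N ->
  \sum_(1 <= j < n.+1 | (e%:Z %| j%:Z - 1)%Z) chi j%:Z =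
  if (d %| e)%N then (totient n %/ totient e)%:R else 0.
Proof.
move=> n_gt0 hchi hd en; have e_gt0 := dvdn_gt0 n_gt0 en.
have modE (j : nat) : (e%:Z %| j%:Z - 1)%Z = (j == 1 %[mod e]).
  by rewrite -eqz_mod_dvd !modz_nat.
(* Extending by 0 outside the class of 1 mod [e] gives a function of period [n], to which the
   reindexing lemmas apply. *)
pose F (j : nat) := if j == 1 %[mod e] then chi j%:Z else 0.
have Fmod j : F (j %% n)%N = F j.
  rewrite /F modn_dvdm //; case: ifP => // _; apply: (dirichlet_congr hchi).
  by rewrite -eqz_mod_dvd -modz_nat modz_mod.
rewrite big_mkcond /= (eq_bigr F); last by move=> j _; rewrite modE.
rewrite (big_period_shift _ Fmod) //.
have [de|nde] := boolP (d %| e)%N.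
  have [[dn [psi hpsi chi_psi]] _] := hd.
  rewrite -(totient_count_mod1 n_gt0 en) mulKn ?totient_gt0 //.
  rewrite natr_sum [RHS]big_mkcond /=; apply: eq_bigr => j _.
  rewrite /F; case: ifP => // j1.
  have cE : coprimez j n = coprime n j by rewrite coprimezE coprime_sym.
  case: (boolP (coprime n j)) => nj; rewrite -cE in nj; last first.
    exact: (dirichlet_eq0 hchi).
  rewrite chi_psi // -(dirichlet1 hpsi); apply: (dirichlet_congr hpsi).
  by rewrite -modE in j1; apply: dvdz_trans j1; rewrite dvdzE.
have [c [nc c1 chic]] : exists c : nat,
    [/\ coprime n c, c = 1 %[mod e] & chi c%:Z != 1].
  apply: contrapT => nex; move/negP: nde; apply.
  apply: (conductor_dvdn n_gt0 hchi hd en) => c cn c1.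
  apply: contrapT => /eqP chic; apply: nex.
  have n_neq0 : n%:Z != 0 by rewrite -lt0n.
  (* The integer witness is reduced mod [n] to a natural number, as [big_period_mul] requires. *)
  pose c0 := `|(c %% n%:Z)%Z|%N.
  have c0E : c0%:Z = (c %% n%:Z)%Z by rewrite gez0_abs // modz_ge0.
  have cc0 : (n%:Z %| c0%:Z - c)%Z by rewrite c0E -eqz_mod_dvd modz_mod.
  exists c0; split.
  - by move: cn; rewrite -(coprimez_congr cc0) coprimezE coprime_sym.
  - apply/eqP; rewrite -modE.
    have -> : c0%:Z - 1 = (c0%:Z - c) + (c - 1) by ring.
    by rewrite rpredD // (dvdz_trans _ cc0).
  - by rewrite (dirichlet_congr hchi cc0).
set S := (X in X = 0).
have SE : S = chi c%:Z * S.
  rewrite {1}/S (big_period_mul _ Fmod n_gt0 nc) mulr_sumr.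
  apply: eq_bigr => j _; rewrite /F.
  have -> : (c * j == 1 %[mod e]) = (j == 1 %[mod e]).
    by rewrite -modnMml c1 modnMml mul1n.
  by case: ifP => _; rewrite ?mulr0 // PoszM (dirichlet_mul hchi).
apply/eqP; have /eqP : (1 - chi c%:Z) * S = 0 by rewrite mulrBl mul1r -SE subrr.
by rewrite mulf_eq0 subr_eq0 eq_sym (negbTE chic).
Qed.

End Characters.

(** * The product formula *)

Section PowerR.

Variables (R : realType) (I : Type) (r : seq I) (P : pred I).

Lemma powR_prod (F : I -> R) (a : R) : (forall i, P i -> 0 <= F i) ->
  (\prod_(i <- r | P i) F i) `^ a = \prod_(i <- r | P i) F i `^ a.
Proof.
move=> F_ge0.
(* Nonnegativity of the partial product is carried along, because [powRM] needs it. *)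
suff [] : 0 <= \prod_(i <- r | P i) F i /\
  (\prod_(i <- r | P i) F i) `^ a = \prod_(i <- r | P i) F i `^ a by [].
elim/big_rec2: _ => [|i u v Pi [v_ge0 vE]]; first by rewrite powR1.
by rewrite mulr_ge0 ?F_ge0 // powRM ?F_ge0 // vE.
Qed.

Lemma powR_sumr (f : I -> R) (y : R) : 0 < y ->
  \prod_(i <- r | P i) y `^ f i = y `^ (\sum_(i <- r | P i) f i).
Proof.
move=> y_gt0; elim/big_rec2: _ => [|i u v _ ->]; first by rewrite powRr0.
by rewrite powRD // (gt_eqF y_gt0) implybT.
Qed.

End PowerR.

Lemma complex_Re_sum (R : realType) (I : Type) (r : seq I) (P : pred I)
    (F : I -> R[i]) :
  complex.Re (\sum_(i <- r | P i) F i) = \sum_(i <- r | P i) complex.Re (F i).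
Proof. by elim/big_rec2: _ => // i u v _ <-; case: (F i) (v) => ? ? [] ? ?. Qed.

Section ProductFormula.

Variables (R : realType) (A : nat -> set nat) (hA : regular_system A).
Variables (x : R) (x_gt1 : 1 < x).

(** Real powers require a real base; for positive [e] the value is already real by [PhiA_gt0], so
    taking the real part loses nothing. *)
Let y (e : nat) : R := complex.Re (PhiA R A e).[x%:C].

Let yE (e : nat) : (0 < e)%N -> (PhiA R A e).[x%:C] = (y e)%:C.
Proof. by move=> /(PhiA_gt0 hA x_gt1)[z _ zE]; rewrite /y zE. Qed.

Let y_gt0 (e : nat) : (0 < e)%N -> 0 < y e.
Proof. by move=> /(PhiA_gt0 hA x_gt1)[z z_gt0 zE]; rewrite /y zE. Qed.

(** This is [prod_PhiA] at [(j, n)_A], with the index set rewritten by [regular_gcdA] as a subset of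
    [A n], ready for exchanging products over [j]. *)
Lemma prod_PhiA_gcdA (j : int) (n : nat) : (0 < n)%N ->
  x ^+ gcdA A j n - 1 =
  \prod_(e <- divisors n | (e \in A n) && (e%:Z %| j)%Z)
    complex.Re (PhiA R A e).[x%:C].
Proof.
move=> n_gt0; have g_gt0 := gcdA_gt0 hA j n_gt0.
have [Ang gj] := gcdA_spec hA j n_gt0.
transitivity (\prod_(e <- divisors (gcdA A j n) | e \in A (gcdA A j n)) y e).
  apply: (@complexI R); rewrite rmorph_prod big_seq_cond.
  rewrite (eq_bigr (fun e => (PhiA R A e).[x%:C])); last first.
    move=> e; rewrite -dvdn_divisors // => /andP[/(dvdn_gt0 g_gt0) e_gt0 _].
    by rewrite yE.
  rewrite -big_seq_cond -horner_prod (prod_PhiA R hA g_gt0) !hornerE.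
  by rewrite rmorphB rmorphXn rmorph1.
rewrite -big_filter -[RHS]big_filter; apply: perm_big.
apply: uniq_perm; rewrite ?filter_uniq ?divisors_uniq // => e.
rewrite !mem_filter -!dvdn_divisors //=; apply/andP/andP => [[Age _]|].
  move: Age; rewrite inE => /(regular_gcdA hA _ _ n_gt0)[Ane ej].
  by rewrite ej mem_set // (regular_dvd hA).
move=> [/andP[Ane ej] _]; move: Ane; rewrite inE => Ane.
have Age : A (gcdA A j n) e by apply/regular_gcdA.
by rewrite mem_set // (regular_dvd hA).
Qed.

Lemma prod_gcdA_character (n : nat) (chi : int -> R[i]) (d : nat) :
    (0 < n)%N -> dirichlet_character n chi -> is_conductor n chi d ->
  (\prod_(1 <= j < n.+1)
     (x ^+ gcdA A (j%:Z - 1) n - 1) `^ complex.Re (chi j%:Z))%:C =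
  \prod_(1 <= delta < n.+1 | (d * delta)%N \in A n)
     (PhiA R A (d * delta)%N).[x%:C] ^+ (totient n %/ totient (d * delta))%N.
Proof.
move=> n_gt0 hchi hd; have [[dn _] _] := hd.
have d_gt0 := dvdn_gt0 n_gt0 dn.
have Agt0 := regular_gt0 hA n_gt0.
transitivity ((\prod_(e <- divisors n | (e \in A n) && (d %| e)%N)
    y e ^+ (totient n %/ totient e))%:C).
  congr (_%:C).
  under eq_bigr => j _.
    rewrite (prod_PhiA_gcdA _ n_gt0) powR_prod.
      over.
    by move=> e /andP[]; rewrite inE => /Agt0/y_gt0/ltW.
  (* After the exchange, the exponent of [y e] is the real part of the sum of [chi] over the
     residues 1 mod [e]. *)
  rewrite (exchange_big_dep (fun e => e \in A n)) /=; last by move=> j e _ /andP[].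
  rewrite [RHS]big_mkcondr /=; apply: eq_bigr => e; rewrite inE => Ane.
  rewrite (eq_bigl (fun j => (e%:Z %| j%:Z - 1)%Z)); last first.
    by move=> j; rewrite mem_set.
  rewrite powR_sumr ?y_gt0 ?Agt0 // -complex_Re_sum.
  rewrite (dirichlet_sum_mod1 n_gt0 hchi hd (regular_dvd hA n_gt0 Ane)).
  case: ifP => _; last by rewrite powRr0.
  rewrite -(rmorph_nat (real_complex R)) /= powR_mulrn // ltW // y_gt0 //.
  exact: Agt0.
(* The multiples of [d] in [A n] are reindexed as [d * k]; the range [1 <= k <= n] suffices because
   [k <= d * k <= n]. *)
rewrite rmorph_prod -big_filter -[RHS]big_filter.
rewrite (perm_big [seq (d * k)%N | k <- index_iota 1 n.+1 & (d * k)%N \in A n]).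
  rewrite big_map; apply: eq_big_seq => k; rewrite mem_filter => /andP[].
  by rewrite inE => /Agt0 dk_gt0 _; rewrite rmorphXn yE.
apply: uniq_perm.
- by rewrite filter_uniq // divisors_uniq.
- rewrite map_inj_uniq ?filter_uniq ?iota_uniq // => a b /eqP.
  by rewrite eqn_pmul2l // => /eqP.
move=> e; rewrite mem_filter -dvdn_divisors //; apply/andP/mapP.
  move=> [/andP[Ane /dvdnP[k eE]] en]; rewrite mulnC in eE.
  exists k => //; rewrite mem_filter -eE Ane mem_index_iota /=.
  have e_gt0 := dvdn_gt0 n_gt0 en.
  have k_gt0 : (0 < k)%N by move: e_gt0; rewrite eE muln_gt0 => /andP[].
  rewrite k_gt0 ltnS (leq_trans _ (dvdn_leq n_gt0 en)) // eE.
  by rewrite leq_pmull.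
move=> [k]; rewrite mem_filter => /andP[Adk _] ->.
rewrite Adk dvdn_mulr //; split=> //; apply: (regular_dvd hA n_gt0).
by move: Adk; rewrite inE.
Qed.

End ProductFormula.

Theorem theorem8 (R : realType) (A : nat -> set nat) (hA : regular_system A)
    (n : nat) (hn : (0 < n)%N) (chi : int -> R[i])
    (hchi : dirichlet_character n chi) (d : nat) (hd : is_conductor n chi d) :
  (forall x : R, 1 < x ->
    (\prod_(1 <= j < n.+1)
        (x ^+ gcdA A (j%:Z - 1) n - 1) `^ complex.Re (chi j%:Z))%:C =
    \prod_(1 <= delta < n.+1 | (d * delta)%N \in A n)
        (PhiA R A (d * delta)%N).[x%:C]
          ^+ (totient n %/ totient (d * delta))%N)
  /\
  (primitive_character n chi ->
    forall x : R, 1 < x ->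
      (PhiA R A n).[x%:C] =
      (\prod_(1 <= j < n.+1)
          (x ^+ gcdA A (j%:Z - 1) n - 1) `^ complex.Re (chi j%:Z))%:C).
Proof.
split=> [x x_gt1|[_ hn_cond] x x_gt1]; first exact: prod_gcdA_character.
rewrite (prod_gcdA_character hA x_gt1 hn hchi hn_cond).
(* With conductor [n], only the index 1 survives: [n * k] in [A n] divides [n], which forces
   [k = 1]. Its exponent is 1. *)
rewrite big_ltn_cond // muln1 mem_set; last exact: regular_id.
rewrite divnn totient_gt0 hn expr1 big1_seq ?mulr1 // => k.
rewrite mem_index_iota => /andP[]; rewrite inE => /(regular_dvd hA hn).
rewrite -{2}(muln1 n) dvdn_pmul2l // dvdn1 => /eqP ->.
by rewrite ltnn.
Qed.
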